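(* Let $\Theta\in\mathbb{R}^{p\times p}$ and $\Psi\in\mathbb{R}^{q\times q}$ be symmetric with $\Theta\oplus\Psi$ positive definite, and let $\Theta=Q_\Theta\Lambda_\Theta Q_\Theta^T$ and $\Psi=Q_\Psi\Lambda_\Psi Q_\Psi^T$ be eigendecompositions ($Q_\Theta,Q_\Psi$ orthogonal, $\Lambda_\Theta,\Lambda_\Psi$ diagonal) where the $k$th smallest eigenvalues $\lambda_{\Theta,k}$ and $\lambda_{\Psi,k}$ are the $(k,k)$ entries of $\Lambda_\Theta$ and $\Lambda_\Psi$. Put $$\Xi_{\Theta,k}=(\Lambda_\Theta+\lambda_{\Psi,k}I_p)^{-1}\ (k=1,\dots,q),\qquad \Xi_{\Psi,l}=(\Lambda_\Psi+\lambda_{\Theta,l}I_q)^{-1}\ (l=1,\dots,p).$$ Then the gradient blocks are $$G_\Theta=qS-Q_\Theta\Big(\sum_{k=1}^q\Xi_{\Theta,k}\Big)Q_\Theta^T,\qquad G_\Psi=pT-Q_\Psi\Big(\sum_{l=1}^p\Xi_{\Psi,l}\Big)Q_\Psi^T,$$ and the Hessian is $$H=\begin{bmatrix}H_\Theta&H_{\Theta\Psi}\\H_{\Theta\Psi}^T&H_\Psi\end{bmatrix}=\begin{bmatrix}Q_\Theta\otimes Q_\Theta&0\\0&Q_\Psi\otimes Q_\Psi\end{bmatrix}\begin{bmatrix}\Lambda_{H_\Theta}&\Upsilon\\\Upsilon^T&\Lambda_{H_\Psi}\end{bmatrix}\begin{bmatrix}Q_\Theta\otimes Q_\Theta&0\\0&Q_\Psi\otimes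 Q_\Psi\end{bmatrix}^T,$$ where $$\Lambda_{H_\Theta}=\sum_{k=1}^q\Xi_{\Theta,k}\otimes\Xi_{\Theta,k},\qquad \Lambda_{H_\Psi}=\sum_{l=1}^p\Xi_{\Psi,l}\otimes\Xi_{\Psi,l},\qquad \Upsilon=\tilde I_{p^2,p}\begin{bmatrix}\lambda_{W,11}^2&\cdots&\lambda_{W,1q}^2\\\vdots&\ddots&\vdots\\\lambda_{W,p1}^2&\cdots&\lambda_{W,pq}^2\end{bmatrix}\tilde I_{q,q^2},$$ with $\lambda_{W,lk}=(\lambda_{\Theta,l}+\lambda_{\Psi,k})^{-1}$, $\tilde I_{p^2,p}=[E_{p,11}\ E_{p,22}\ \cdots\ E_{p,pp}]^T$ and $\tilde I_{q,q^2}=[E_{q,11}\ E_{q,22}\ \cdots\ E_{q,qq}]$.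
   Context: $p,q,n\ge1$ are integers. $I_a$ is the $a\times a$ identity, $\otimes$ the Kronecker product, $\Theta\oplus\Psi=\Theta\otimes I_q+I_p\otimes\Psi$. $e_{a,i}$ is the $i$th standard basis vector of $\mathbb{R}^a$, and $E_{a,ij}=e_{a,i}e_{a,j}^T$ is the $a\times a$ matrix with a single $1$ at position $(i,j)$. Given data $Y^1,\dots,Y^n\in\mathbb{R}^{q\times p}$, $S=\frac1{nq}\sum_{i}Y^{iT}Y^i$ and $T=\frac1{np}\sum_iY^iY^{iT}$. The function under consideration is $g(\Theta,\Psi)=q\operatorname{tr}(S\Theta)+p\operatorname{tr}(T\Psi)-\log|\Theta\oplus\Psi|$. With $W=(\Theta\oplus\Psi)^{-1}$, its gradient with respect to $\Theta$ and $\Psi$ consists of $$G_\Theta=qS-\sum_{i=1}^q(I_p\otimes e_{q,i})^TW(I_p\otimes e_{q,i}),\qquad G_\Psi=pT-\sum_{j=1}^p(e_{p,j}\otimes I_q)^TW(e_{p,j}\otimes I_q),$$ and its Hessian (acting on the stacked vector $[\operatorname{vec}(\Delta_\Theta)^T,\operatorname{vec}(\Delta_\Psi)^T]^T$ of symmetric directions, $\operatorname{vec}$ stacking columns) is the $(p^2+q^2)\times(p^2+q^2)$ matrix $H=P^T(W\otimes W)P$, with $P=[P_\Theta,P_\Psi]$, $P_\Theta=\sum_{i=1}^qI_p\otimes e_{q,i}\otimes I_p\otimes e_{q,i}$, $P_\Psi=\sum_{j=1}^pe_{p,j}\otimes I_q\otimes e_{p,j}\otimes I_q$; its blocks are $H_\Theta=P_\Theta^T(W\otimes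 W)P_\Theta$, $H_{\Theta\Psi}=P_\Theta^T(W\otimes W)P_\Psi$, $H_\Psi=P_\Psi^T(W\otimes W)P_\Psi$. *)

(* Defs.v *)
From mathcomp Require Import all_boot all_order all_algebra.
From mathcomp Require Import reals.
From mathcomp Require Export mxtens.

Set Implicit Arguments.
Unset Strict Implicit.
Unset Printing Implicit Defensive.

Import Order.TTheory GRing.Theory Num.Theory.
Local Open Scope ring_scope.

Definition posdefmx (R : realType) (m : nat) (A : 'M[R]_m) : Prop :=
  A^T = A /\ forall x : 'cV[R]_m, x != 0 -> 0 < (x^T *m A *m x) 0 0.

Definition orthogonal_mx (R : realType) (m : nat) (Q : 'M[R]_m) : Prop :=
  Q *m Q^T = 1%:M /\ Q^T *m Q = 1%:M.

(* The eigenvalues are listed with multiplicity in nondecreasing order, so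
   [lam 0 k] is the (k+1)-st smallest one (indices start at 0). *)
Definition sorted_eigendecomposition (R : realType) (m : nat)
    (A Q : 'M[R]_m) (lam : 'rV[R]_m) : Prop :=
  [/\ orthogonal_mx Q,
      A = Q *m diag_mx lam *m Q^T
    & forall i j : 'I_m, (i <= j)%N -> lam 0 i <= lam 0 j].

Definition kronsum (R : realType) (p q : nat)
    (Theta : 'M[R]_p) (Psi : 'M[R]_q) : 'M[R]_(p * q) :=
  Theta *t 1%:M + 1%:M *t Psi.

Definition sampleS (R : realType) (p q n : nat) (Y : 'I_n -> 'M[R]_(q, p)) :
    'M[R]_p :=
  (n * q)%:R^-1 *: \sum_(i < n) ((Y i)^T *m Y i).

Definition sampleT (R : realType) (p q n : nat) (Y : 'I_n -> 'M[R]_(q, p)) :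
    'M[R]_q :=
  (n * p)%:R^-1 *: \sum_(i < n) (Y i *m (Y i)^T).

(* [I_p (x) e_(q,i)] and [e_(p,j) (x) I_q]; the casts identify the column
   dimensions [p * 1] with [p] and [1 * q] with [q]. *)
Definition tens_Ie (R : realType) (p q : nat) (i : 'I_q) : 'M[R]_(p * q, p) :=
  castmx (erefl, muln1 p) (1%:M *t (delta_mx i 0 : 'cV[R]_q)).

Definition tens_eI (R : realType) (p q : nat) (j : 'I_p) : 'M[R]_(p * q, q) :=
  castmx (erefl, mul1n q) ((delta_mx j 0 : 'cV[R]_p) *t 1%:M).

(* For [g(Theta, Psi) = q tr(S Theta) + p tr(T Psi) - log |Theta (+) Psi|],
   with [W] the inverse of [Theta (+) Psi], the following are the two gradient
   blocks and the Hessian of [g]. *)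
Definition gradTheta (R : realType) (p q : nat)
    (S : 'M[R]_p) (W : 'M[R]_(p * q)) : 'M[R]_p :=
  q%:R *: S - \sum_(i < q) ((tens_Ie R p i)^T *m W *m tens_Ie R p i).

Definition gradPsi (R : realType) (p q : nat)
    (T : 'M[R]_q) (W : 'M[R]_(p * q)) : 'M[R]_q :=
  p%:R *: T - \sum_(j < p) ((tens_eI R q j)^T *m W *m tens_eI R q j).

(* The four-fold product [I_p (x) e_(q,i) (x) I_p (x) e_(q,i)] is bracketed in
   pairs, and likewise [e_(p,j) (x) I_q (x) e_(p,j) (x) I_q]. *)
Definition PTheta (R : realType) (p q : nat) :
    'M[R]_((p * q) * (p * q), p * p) :=
  \sum_(i < q) (tens_Ie R p i *t tens_Ie R p i).

Definition PPsi (R : realType) (p q : nat) :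
    'M[R]_((p * q) * (p * q), q * q) :=
  \sum_(j < p) (tens_eI R q j *t tens_eI R q j).

Definition hessian (R : realType) (p q : nat) (W : 'M[R]_(p * q)) :
    'M[R]_(p * p + q * q) :=
  let P := row_mx (PTheta R p q) (PPsi R p q) in P^T *m (W *t W) *m P.

Definition hessTheta (R : realType) (p q : nat) (W : 'M[R]_(p * q)) :
    'M[R]_(p * p) :=
  (PTheta R p q)^T *m (W *t W) *m PTheta R p q.

Definition hessThetaPsi (R : realType) (p q : nat) (W : 'M[R]_(p * q)) :
    'M[R]_(p * p, q * q) :=
  (PTheta R p q)^T *m (W *t W) *m PPsi R p q.

Definition hessPsi (R : realType) (p q : nat) (W : 'M[R]_(p * q)) :
    'M[R]_(q * q) :=
  (PPsi R p q)^T *m (W *t W) *m PPsi R p q.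

(* [Xi lamT lamP k] is [Xi_(Theta,k)] and [Xi lamP lamT l] is [Xi_(Psi,l)]. *)
Definition Xi (R : realType) (a b : nat) (lamA : 'rV[R]_a) (lamB : 'rV[R]_b)
    (k : 'I_b) : 'M[R]_a :=
  invmx (diag_mx lamA + (lamB 0 k)%:M).

Lemma sum_const_ord (m n : nat) : (\sum_(i < m) n = m * n)%N.
Proof. by rewrite sum_nat_const card_ord. Qed.

(* [E_(a,11) E_(a,22) ... E_(a,aa)], the blocks side by side. *)
Definition Itilde (R : realType) (a : nat) : 'M[R]_(a, a * a) :=
  castmx (erefl, sum_const_ord a a) (\mxrow_(k < a) (delta_mx k k : 'M[R]_a)).

Definition lamW (R : realType) (p q : nat) (lamT : 'rV[R]_p) (lamP : 'rV[R]_q)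
    (l : 'I_p) (k : 'I_q) : R :=
  (lamT 0 l + lamP 0 k)^-1.

Definition Upsilon (R : realType) (p q : nat)
    (lamT : 'rV[R]_p) (lamP : 'rV[R]_q) : 'M[R]_(p * p, q * q) :=
  (Itilde R p)^T *m (\matrix_(l < p, k < q) lamW lamT lamP l k ^+ 2)
    *m Itilde R q.

(* Main.v *)
(* If u_l and v_k are the columns of QTheta and QPsi, then the vectors
   u_l (x) v_k form an orthonormal eigenbasis of Theta (+) Psi, so W is the sum
   over l, k of lamW l k *: (u_l u_l^T (x) v_k v_k^T), where positive
   definiteness makes each lamTheta l + lamPsi k positive.  The selection
   matrices of the gradient and the Hessian act on a pure Kronecker product
   by partial traces and, in the mixed block, by extracting columns and rows;
   orthonormality then eliminates all cross terms. *)
Require Import Defs.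
From mathcomp Require Import all_boot all_order all_algebra.
From mathcomp Require Import reals.

Set Implicit Arguments.
Unset Strict Implicit.
Unset Printing Implicit Defensive.

Import Order.TTheory GRing.Theory Num.Theory.
Local Open Scope ring_scope.

(** * Kronecker products *)

Section TensLinear.
Variables (R : comPzRingType) (m n m' n' : nat).

Lemma tensmxZl a (A : 'M[R]_(m, n)) (B : 'M_(m', n')) :
  (a *: A) *t B = a *: (A *t B).
Proof. by apply/matrixP=> i j; rewrite !mxE mulrA. Qed.

Lemma tensmxZr a (A : 'M[R]_(m, n)) (B : 'M_(m', n')) :
  A *t (a *: B) = a *: (A *t B).
Proof. by apply/matrixP=> i j; rewrite !mxE mulrCA. Qed.

Lemma tensmx_suml I (r : seq I) (F : I -> 'M[R]_(m, n)) (B : 'M_(m', n')) :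
  (\sum_(i <- r) F i) *t B = \sum_(i <- r) (F i *t B).
Proof.
apply/matrixP=> i j; rewrite !(mxE, summxE) mulr_suml.
by apply: eq_bigr => k _; rewrite mxE.
Qed.

Lemma tensmx_sumr I (r : seq I) (A : 'M[R]_(m, n)) (F : I -> 'M_(m', n')) :
  A *t (\sum_(i <- r) F i) = \sum_(i <- r) (A *t F i).
Proof.
apply/matrixP=> i j; rewrite !(mxE, summxE) mulr_sumr.
by apply: eq_bigr => k _; rewrite mxE.
Qed.

Lemma tens1mx1 : (1%:M : 'M[R]_m) *t (1%:M : 'M[R]_n) = 1%:M.
Proof.
apply/matrixP=> i j.
case: (mxtens_indexP i) => i1 i2; case: (mxtens_indexP j) => j1 j2.
rewrite tensmxE !mxE (can_eq (@mxtens_indexK m n)) xpair_eqE.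
by case: eqP; case: eqP => _ _ /=; rewrite ?mulr0 ?mul0r ?mulr1.
Qed.

End TensLinear.

(** * Selection matrices acting on pure Kronecker products *)

Section Selection.
Variables (R : realType) (p q : nat).

Lemma tens_IeE (i : 'I_q) a b c :
  tens_Ie R p i (mxtens_index (a, b)) c = (a == c)%:R * (b == i)%:R.
Proof.
rewrite /tens_Ie castmxE /= cast_ord_id.
have -> : cast_ord (esym (muln1 p)) c = mxtens_index (c, 0 : 'I_1).
  by apply: val_inj; rewrite /= muln1 addn0.
by rewrite tensmxE !mxE eqxx andbT.
Qed.

Lemma tens_eIE (j : 'I_p) a b c :
  tens_eI R q j (mxtens_index (a, b)) c = (a == j)%:R * (b == c)%:R.
Proof.
rewrite /tens_eI castmxE /= cast_ord_id.
have -> : cast_ord (esym (mul1n q)) c = mxtens_index (0 : 'I_1, c).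
  by apply: val_inj.
by rewrite tensmxE !mxE eqxx andbT.
Qed.

Lemma sum_mxtens (F : 'I_(p * q) -> R) :
  \sum_x F x = \sum_a \sum_b F (mxtens_index (a, b)).
Proof.
rewrite pair_big /= (reindex (@mxtens_index p q)) /=.
  by apply: eq_bigr => -[].
by exists (@mxtens_unindex p q) => x _; rewrite ?mxtens_indexK ?mxtens_unindexK.
Qed.

Lemma sum_delta (T : finType) (F : T -> R) (a : T) :
  \sum_x (x == a)%:R * F x = F a.
Proof.
rewrite (bigD1 a) //= eqxx mul1r big1 ?addr0 // => x /negbTE->.
by rewrite mul0r.
Qed.

Lemma sum_delta_scale (T : finType) (V : lmodType R) (F : T -> V) a :
  \sum_x (a == x)%:R *: F x = F a.
Proof.
rewrite (bigD1 a) //= eqxx scale1r big1 ?addr0 // => x.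
by rewrite eq_sym => /negbTE->; rewrite scale0r.
Qed.

Lemma mul_tens_IeT n (i : 'I_q) (M : 'M[R]_(p * q, n)) a x :
  ((tens_Ie R p i)^T *m M) a x = M (mxtens_index (a, i)) x.
Proof.
(* Deltas are inserted on the right so that the double sum over pairs can be compared term by
   term. *)
rewrite mxE sum_mxtens -[RHS](sum_delta (fun a => M (mxtens_index (a, i)) x)).
apply: eq_bigr => b _.
rewrite -[X in _ * X](sum_delta (fun i => M (mxtens_index (b, i)) x)) mulr_sumr.
by apply: eq_bigr => c _; rewrite mxE tens_IeE mulrA.
Qed.

Lemma mul_tens_eIT n (j : 'I_p) (M : 'M[R]_(p * q, n)) b x :
  ((tens_eI R q j)^T *m M) b x = M (mxtens_index (j, b)) x.
Proof.
rewrite mxE sum_mxtens -[RHS](sum_delta (fun a => M (mxtens_index (a, b)) x)).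
apply: eq_bigr => a _.
rewrite -[X in _ * X](sum_delta (fun i => M (mxtens_index (a, i)) x)) mulr_sumr.
by apply: eq_bigr => c _; rewrite mxE tens_eIE mulrA.
Qed.

Lemma mul_tens_Ie n (i : 'I_q) (M : 'M[R]_(n, p * q)) x a :
  (M *m tens_Ie R p i) x a = M x (mxtens_index (a, i)).
Proof. by rewrite -[M *m _]trmxK mxE trmx_mul mul_tens_IeT mxE. Qed.

Lemma mul_tens_eI n (j : 'I_p) (M : 'M[R]_(n, p * q)) x b :
  (M *m tens_eI R q j) x b = M x (mxtens_index (j, b)).
Proof. by rewrite -[M *m _]trmxK mxE trmx_mul mul_tens_eIT mxE. Qed.

Lemma tens_Ie_tens_Ie i i' (A : 'M[R]_p) (B : 'M[R]_q) :
  (tens_Ie R p i)^T *m (A *t B) *m tens_Ie R p i' = B i i' *: A.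
Proof.
by apply/matrixP=> a c; rewrite mul_tens_Ie mul_tens_IeT tensmxE mxE mulrC.
Qed.

Lemma tens_eI_tens_eI j j' (A : 'M[R]_p) (B : 'M[R]_q) :
  (tens_eI R q j)^T *m (A *t B) *m tens_eI R q j' = A j j' *: B.
Proof. by apply/matrixP=> a c; rewrite mul_tens_eI mul_tens_eIT tensmxE mxE. Qed.

(** The left factor fixes the row index of [B] and the right one the column index of [A], so each
    entry splits as [A a j * B i c]. *)
Lemma tens_Ie_tens_eI i j (A : 'M[R]_p) (B : 'M[R]_q) :
  (tens_Ie R p i)^T *m (A *t B) *m tens_eI R q j = col j A *m row i B.
Proof.
apply/matrixP=> a c; rewrite mul_tens_eI mul_tens_IeT tensmxE.
by rewrite mxE big_ord1 !mxE.
Qed.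

Lemma mulmx_trsum_sum m m' n n' (I J : finType) (F : I -> 'M[R]_(m', m))
    (M : 'M[R]_(m', n')) (G : J -> 'M[R]_(n', n)) :
  (\sum_i F i)^T *m M *m (\sum_j G j) = \sum_i \sum_j ((F i)^T *m M *m G j).
Proof.
rewrite [(\sum_i F i)^T]raddf_sum /= !mulmx_suml.
by apply: eq_bigr => i _; rewrite mulmx_sumr.
Qed.

Lemma tensmx_sum_sum m n (I J : finType) (F : I -> 'M[R]_(m, n))
    m' n' (G : J -> 'M[R]_(m', n')) a b (A : 'M[R]_(a, m * m'))
    (B : 'M[R]_(n * n', b)) :
  A *m ((\sum_i F i) *t (\sum_j G j)) *m B
    = \sum_i \sum_j (A *m (F i *t G j) *m B).
Proof.
rewrite tensmx_suml mulmx_sumr mulmx_suml; apply: eq_bigr => i _.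
by rewrite tensmx_sumr mulmx_sumr mulmx_suml.
Qed.

(** By the mixed-product rule the term at [i], [j] is [B i j * B' i j] times [A *t A']; these
    scalars add up to the Frobenius inner product of [B] and [B']. *)
Lemma PTheta_tens (A A' : 'M[R]_p) (B B' : 'M[R]_q) :
  (PTheta R p q)^T *m ((A *t B) *t (A' *t B')) *m PTheta R p q
    = \tr (B *m B'^T) *: (A *t A').
Proof.
rewrite /PTheta mulmx_trsum_sum scaler_suml.
apply: eq_bigr => i _; rewrite mxE scaler_suml; apply: eq_bigr => j _.
by rewrite trmx_tens !tensmx_mul !tens_Ie_tens_Ie tensmxZl tensmxZr scalerA mxE.
Qed.

Lemma PPsi_tens (A A' : 'M[R]_p) (B B' : 'M[R]_q) :
  (PPsi R p q)^T *m ((A *t B) *t (A' *t B')) *m PPsi R p q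
    = \tr (A *m A'^T) *: (B *t B').
Proof.
rewrite /PPsi mulmx_trsum_sum scaler_suml.
apply: eq_bigr => i _; rewrite mxE scaler_suml; apply: eq_bigr => j _.
by rewrite trmx_tens !tensmx_mul !tens_eI_tens_eI tensmxZl tensmxZr scalerA mxE.
Qed.

(** For rank-one factors the term at [i], [j] is v_i v'_i u_j u'_j times a matrix independent of [i]
    and [j], so the double sum separates into two inner products. *)
Lemma PTheta_PPsi_tens (u u' : 'cV[R]_p) (v v' : 'cV[R]_q) :
  (PTheta R p q)^T *m (((u *m u^T) *t (v *m v^T)) *t ((u' *m u'^T) *t (v' *m v'^T)))
      *m PPsi R p q
    = (\tr (u *m u'^T) * \tr (v *m v'^T)) *: ((u *t u') *m (v *t v')^T).
Proof.
rewrite /PTheta /PPsi mulmx_trsum_sum.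
(* The traces are swapped because the outer sum, coming from [PTheta], runs over the coordinates of
   [v]. *)
rewrite mulrC mulr_suml scaler_suml; apply: eq_bigr => i _.
rewrite mulr_sumr scaler_suml; apply: eq_bigr => j _.
rewrite !trmx_tens 2!tensmx_mul !tens_Ie_tens_eI tensmx_mul.
have colE n (w : 'cV[R]_n) k : col k (w *m w^T) = w k 0 *: w.
  by apply/matrixP=> a b; rewrite !mxE big_ord1 !mxE (ord1 b) mulrC.
have rowE n (w : 'cV[R]_n) k : row k (w *m w^T) = w k 0 *: w^T.
  by apply/matrixP=> a b; rewrite !mxE big_ord1 !mxE (ord1 a).
rewrite !colE !rowE -!(scalemxAl, scalemxAr) !(tensmxZl, tensmxZr) !scalerA.
congr (_ *: _); rewrite !mxE !big_ord1 !mxE.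
by rewrite mulrACA [RHS]mulrC.
Qed.

Lemma sum_tens_Ie (A : 'M[R]_p) (B : 'M[R]_q) :
  \sum_i ((tens_Ie R p i)^T *m (A *t B) *m tens_Ie R p i) = \tr B *: A.
Proof.
by rewrite scaler_suml; apply: eq_bigr => i _; rewrite tens_Ie_tens_Ie.
Qed.

Lemma sum_tens_eI (A : 'M[R]_p) (B : 'M[R]_q) :
  \sum_j ((tens_eI R q j)^T *m (A *t B) *m tens_eI R q j) = \tr A *: B.
Proof.
by rewrite scaler_suml; apply: eq_bigr => i _; rewrite tens_eI_tens_eI.
Qed.

End Selection.

(** In Kronecker column indices, the transpose of [Itilde] is seen to send each basis vector e_r to
    [e_r *t e_r]. *)
Lemma ItildeE (R : realType) a (r k c : 'I_a) :
  Itilde R a r (mxtens_index (k, c)) = ((r == k) && (c == k))%:R.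
Proof.
rewrite /Itilde castmxE cast_ord_id.
set x := cast_ord _ _.
suff -> : x = tagnat.Rank k c.
  (* [Rank2K] returns the offset with a cast along [a = a]; abstracting the equation lets
     [cast_ord_id] remove it. *)
  rewrite mxE tagnat.Rank2K; move: (congr1 _ _) => e.
  by rewrite cast_ord_id tagnat.Rank1K mxE.
(* The [k] preceding blocks have width [a] each, so both indices have value [k * a + c]. *)
apply: val_inj; rewrite [RHS]tagnat.RankEsum /=.
by rewrite (big_ord_narrow (ltnW (ltn_ord k))) sum_nat_const card_ord.
Qed.

(** * Eigendecompositions *)

Section RankOne.
Variables (R : realType).

Lemma mulmx_diag_outer m (Q : 'M[R]_m) (d : 'rV[R]_m) :
  Q *m diag_mx d *m Q^T = \sum_l d 0 l *: (col l Q *m (col l Q)^T).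
Proof.
apply/matrixP=> i j; rewrite mul_mx_diag !(mxE, summxE).
by apply: eq_bigr => l _; rewrite !mxE big_ord1 !mxE mulrA [d 0 l * _]mulrC.
Qed.

Lemma mulmx_outer m m' n n' (A : 'M[R]_(m, m')) (M : 'M[R]_(m', n'))
    (B : 'M[R]_(n, n')) :
  A *m M *m B^T = \sum_l \sum_k M l k *: (col l A *m (col k B)^T).
Proof.
apply/matrixP=> i j; rewrite exchange_big summxE mxE /=.
apply: eq_bigr => k _; rewrite summxE !mxE mulr_suml.
by apply: eq_bigr => l _; rewrite !mxE big_ord1 !mxE mulrA [M l k * _]mulrC.
Qed.

Section Orthogonal.
Variables (m : nat) (Q : 'M[R]_m).
Hypothesis orthQ : orthogonal_mx Q.

Lemma sum_outer_col : \sum_l col l Q *m (col l Q)^T = 1%:M.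
Proof.
rewrite -orthQ.1 -[X in _ = X *m _]mulmx1 -diag_const_mx mulmx_diag_outer.
by apply: eq_bigr => l _; rewrite mxE scale1r.
Qed.

Lemma mulmx_col_col l l' : (col l Q)^T *m col l' Q = (l == l')%:R%:M.
Proof.
have := congr1 (fun A : 'M[R]_m => A l l') orthQ.2; rewrite !mxE => e.
apply/matrixP=> i j; rewrite !ord1 [RHS]mxE eqxx mulr1n -e mxE.
by apply: eq_bigr => k _; rewrite !mxE.
Qed.

Lemma mxtrace_col_col l l' : \tr (col l Q *m (col l' Q)^T) = (l == l')%:R.
Proof. by rewrite mxtrace_mulC mulmx_col_col mxtrace_scalar eq_sym. Qed.

(** Projectors onto distinct columns are Frobenius-orthogonal; this removes the cross terms from
    [hessTheta] and [hessPsi]. *)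
Lemma mxtrace_outer_outer l l' :
  \tr ((col l Q *m (col l Q)^T) *m (col l' Q *m (col l' Q)^T)^T)
    = (l == l')%:R.
Proof.
rewrite trmx_mul trmxK mulmxA -(mulmxA (col l Q)) mulmx_col_col.
rewrite mul_mx_scalar -scalemxAl mxtraceZ mxtrace_col_col.
by case: eqP; rewrite ?mulr0 ?mulr1.
Qed.

Lemma mulmx_eigencol (A : 'M[R]_m) (lam : 'rV[R]_m) l :
  A = Q *m diag_mx lam *m Q^T -> A *m col l Q = lam 0 l *: col l Q.
Proof.
move=> ->; rewrite mulmx_diag_outer mulmx_suml (bigD1 l) //= big1 => [|k ne_kl].
  by rewrite addr0 -scalemxAl -mulmxA mulmx_col_col eqxx mulmx1.
rewrite -scalemxAl -mulmxA mulmx_col_col (negbTE ne_kl).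
by rewrite raddf0 mulmx0 scaler0.
Qed.

End Orthogonal.

(** [invmx] returns its argument on singular matrices, hence the condition that no diagonal entry
    vanishes. *)
Lemma Xi_diag a b (lamA : 'rV[R]_a) (lamB : 'rV[R]_b) k :
  (forall l, lamA 0 l + lamB 0 k != 0) ->
  Xi lamA lamB k = diag_mx (\row_l (lamA 0 l + lamB 0 k)^-1).
Proof.
move=> nz; set D := diag_mx _; rewrite /Xi; set M := _ + _.
have MD : M *m D = 1%:M.
  rewrite /M -diag_const_mx -raddfD mulmx_diag -diag_const_mx.
  by congr diag_mx; apply/rowP=> l; rewrite !mxE mulfV.
have uM : M \in unitmx by case/mulmx1_unit: MD.
by rewrite -[LHS]mulmx1 -MD mulKmx.
Qed.

(** The transpose of [Itilde] selects from [Q *t Q] the columns [col l Q *t col l Q]; the result is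
    a weighted sum of outer products, comparable with the mixed Hessian block. *)
Lemma Upsilon_conj p q (A : 'M[R]_p) (B : 'M[R]_q)
    (lamT : 'rV[R]_p) (lamP : 'rV[R]_q) :
  (A *t A) *m Upsilon lamT lamP *m (B *t B)^T
    = \sum_l \sum_k lamW lamT lamP l k ^+ 2
        *: ((col l A *t col l A) *m (col k B *t col k B)^T).
Proof.
have colQ n (Q : 'M[R]_n) l :
    col l ((Q *t Q) *m (Itilde R n)^T) = col l Q *t col l Q.
  apply/matrixP=> x y.
  (* The column index lives in ['I_(1 * 1)] and must be a pair before [tensmxE] applies. *)
  have -> : y = mxtens_index (0 : 'I_1, 0 : 'I_1) by rewrite ord1; apply: val_inj.
  case: (mxtens_indexP x) => i j.
  rewrite (tensmxE (col l Q) (col l Q)) !mxE sum_mxtens.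
  rewrite -[RHS](sum_delta (fun a => Q i a * Q j l)).
  apply: eq_bigr => a _; rewrite -(sum_delta (fun b => Q i a * Q j b)) mulr_sumr.
  apply: eq_bigr => b _; rewrite tensmxE mxE ItildeE (eq_sym l).
  by rewrite mulrC; case: (a =P l) => [->|_] /=; rewrite ?mul1r ?mul0r.
(* Regrouping as X M Y^T, where X and Y are [A *t A] and [B *t B] times a transposed [Itilde]. *)
rewrite /Upsilon !mulmxA -mulmxA -{1}[Itilde R q]trmxK -trmx_mul mulmx_outer.
apply: eq_bigr => l _; apply: eq_bigr => k _.
by rewrite !colQ !mxE.
Qed.

End RankOne.

(** * Spectral form of the inverse Kronecker sum *)

Section KronsumInverse.
Variables (R : realType) (p q : nat) (Theta : 'M[R]_p) (Psi : 'M[R]_q).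
Variables (QT : 'M[R]_p) (lamT : 'rV[R]_p) (QP : 'M[R]_q) (lamP : 'rV[R]_q).
Hypotheses (posK : posdefmx (kronsum Theta Psi)).
Hypotheses (orthT : orthogonal_mx QT) (orthP : orthogonal_mx QP).
Hypothesis eT : Theta = QT *m diag_mx lamT *m QT^T.
Hypothesis eP : Psi = QP *m diag_mx lamP *m QP^T.

Local Notation uu l := (col l QT *m (col l QT)^T).
Local Notation vv k := (col k QP *m (col k QP)^T).
Local Notation W := (invmx (kronsum Theta Psi)).
Local Notation w l k := (lamW lamT lamP l k).

Lemma kronsum_eigen l k :
  kronsum Theta Psi *m (col l QT *t col k QP)
    = (lamT 0 l + lamP 0 k) *: (col l QT *t col k QP).
Proof.
rewrite /kronsum mulmxDl !tensmx_mul !mul1mx.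
rewrite (mulmx_eigencol orthT _ eT) (mulmx_eigencol orthP _ eP).
by rewrite tensmxZl tensmxZr scalerDl.
Qed.

(** The quadratic form of the Kronecker sum at the unit vector [col l QT *t col k QP] equals this
    eigenvalue. *)
Lemma eigensum_gt0 l k : 0 < lamT 0 l + lamP 0 k.
Proof.
pose x := col l QT *t col k QP.
have xx : (x^T *m x) 0 0 = 1.
  rewrite /x trmx_tens tensmx_mul !mulmx_col_col // !eqxx.
  by rewrite !mxE !eqxx !mulr1n mulr1.
have x0 : x != 0.
  by apply/eqP=> x0; move: xx; rewrite x0 mulmx0 mxE => /esym/eqP; rewrite oner_eq0.
have := posK.2 x x0; rewrite -mulmxA kronsum_eigen -scalemxAr mxE -/x.
by rewrite xx mulr1.
Qed.

Lemma invmx_kronsum : W = \sum_l \sum_k w l k *: (uu l *t vv k).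
Proof.
set V := (X in _ = X).
suff KV : kronsum Theta Psi *m V = 1%:M.
  have uK : kronsum Theta Psi \in unitmx by case/mulmx1_unit: KV.
  by rewrite -[LHS]mulmx1 -KV mulKmx.
(* The identity is resolved into projectors in both factors, so each term only asks that the
   eigenvalue cancel its weight [w l k]. *)
rewrite -tens1mx1 -(sum_outer_col orthT) -(sum_outer_col orthP).
rewrite tensmx_suml mulmx_sumr; apply: eq_bigr => l _.
rewrite tensmx_sumr mulmx_sumr; apply: eq_bigr => k _.
rewrite -scalemxAr -tensmx_mul mulmxA kronsum_eigen -scalemxAl scalerA.
by rewrite mulVf ?scale1r // gt_eqF ?eigensum_gt0.
Qed.

Lemma Xi_conjT k : QT *m Xi lamT lamP k *m QT^T = \sum_l w l k *: uu l.
Proof.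
rewrite Xi_diag => [|l]; last by rewrite gt_eqF ?eigensum_gt0.
by rewrite mulmx_diag_outer; apply: eq_bigr => l _; rewrite mxE.
Qed.

Lemma Xi_conjP l : QP *m Xi lamP lamT l *m QP^T = \sum_k w l k *: vv k.
Proof.
rewrite Xi_diag => [|k]; last by rewrite addrC gt_eqF ?eigensum_gt0.
by rewrite mulmx_diag_outer; apply: eq_bigr => k _; rewrite mxE addrC.
Qed.

(** Summing over [l] first leaves the projectors [vv k] as second factors, whose traces are all that
    [tens_Ie] and [PTheta] then produce. *)
Lemma invmx_kronsumT :
  W = \sum_k ((QT *m Xi lamT lamP k *m QT^T) *t vv k).
Proof.
rewrite invmx_kronsum exchange_big; apply: eq_bigr => k _.
by rewrite Xi_conjT tensmx_suml; apply: eq_bigr => l _; rewrite tensmxZl.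
Qed.

Lemma invmx_kronsumP :
  W = \sum_l (uu l *t (QP *m Xi lamP lamT l *m QP^T)).
Proof.
rewrite invmx_kronsum; apply: eq_bigr => l _.
by rewrite Xi_conjP tensmx_sumr; apply: eq_bigr => k _; rewrite tensmxZr.
Qed.

(** * Closed forms of the gradient and Hessian blocks *)

Lemma gradThetaE (S : 'M[R]_p) :
  gradTheta S W = q%:R *: S - QT *m (\sum_k Xi lamT lamP k) *m QT^T.
Proof.
congr (_ - _); rewrite mulmx_sumr mulmx_suml {1}invmx_kronsumT.
under eq_bigr do rewrite mulmx_sumr mulmx_suml.
rewrite exchange_big; apply: eq_bigr => k _.
by rewrite sum_tens_Ie mxtrace_col_col // eqxx scale1r.
Qed.

Lemma gradPsiE (T : 'M[R]_q) :
  gradPsi T W = p%:R *: T - QP *m (\sum_l Xi lamP lamT l) *m QP^T.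
Proof.
congr (_ - _); rewrite mulmx_sumr mulmx_suml {1}invmx_kronsumP.
under eq_bigr do rewrite mulmx_sumr mulmx_suml.
rewrite exchange_big; apply: eq_bigr => k _.
by rewrite sum_tens_eI mxtrace_col_col // eqxx scale1r.
Qed.

Lemma hessThetaE :
  hessTheta W = (QT *t QT) *m (\sum_k (Xi lamT lamP k *t Xi lamT lamP k))
    *m (QT *t QT)^T.
Proof.
rewrite /hessTheta invmx_kronsumT tensmx_sum_sum mulmx_sumr mulmx_suml.
apply: eq_bigr => k _.
(* The trace factor is a Kronecker delta, so only the diagonal of the double sum survives. *)
under eq_bigr do rewrite PTheta_tens mxtrace_outer_outer //.
by rewrite sum_delta_scale trmx_tens !tensmx_mul.
Qed.

Lemma hessPsiE :
  hessPsi W = (QP *t QP) *m (\sum_l (Xi lamP lamT l *t Xi lamP lamT l))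
    *m (QP *t QP)^T.
Proof.
rewrite /hessPsi invmx_kronsumP tensmx_sum_sum mulmx_sumr mulmx_suml.
apply: eq_bigr => k _.
under eq_bigr do rewrite PPsi_tens mxtrace_outer_outer //.
by rewrite sum_delta_scale trmx_tens !tensmx_mul.
Qed.

(** Both copies of [W] are expanded over both indices; the two traces force [l = l'] and [k = k'],
    which squares the weight [w l k]. *)
Lemma hessThetaPsiE :
  hessThetaPsi W = (QT *t QT) *m Upsilon lamT lamP *m (QP *t QP)^T.
Proof.
rewrite Upsilon_conj /hessThetaPsi invmx_kronsum tensmx_sum_sum.
apply: eq_bigr => l _.
(* The right side is inflated to a delta-weighted sum over [l'], with the square split as
   [w l k * w l' k] to match the left side. *)
rewrite -[RHS](sum_delta_scale (fun l' => \sum_k (w l k * w l' k)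
  *: ((col l QT *t col l' QT) *m (col k QP *t col k QP)^T))).
apply: eq_bigr => l' _; rewrite tensmx_sum_sum scaler_sumr.
apply: eq_bigr => k _.
rewrite -[in RHS](sum_delta_scale (fun k' => (w l k * w l' k')
  *: ((col l QT *t col l' QT) *m (col k QP *t col k' QP)^T))) scaler_sumr.
apply: eq_bigr => k' _.
rewrite tensmxZl tensmxZr !scalerA -scalemxAr -scalemxAl.
by rewrite PTheta_PPsi_tens !mxtrace_col_col // !scalerA mulrC.
Qed.

End KronsumInverse.

(** Symmetry of [W] makes the lower left block the transpose of the upper right one. *)
Lemma hessian_block (R : realType) p q (W : 'M[R]_(p * q)) : W^T = W ->
  hessian W = block_mx (hessTheta W) (hessThetaPsi W)
                       (hessThetaPsi W)^T (hessPsi W).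
Proof.
move=> symW; rewrite /hessian tr_row_mx mul_col_mx mul_col_row.
by rewrite /hessThetaPsi !trmx_mul trmxK trmx_tens symW mulmxA.
Qed.

Theorem theorem3 (R : realType) (p q n : nat)
    (hp : (1 <= p)%N) (hq : (1 <= q)%N) (hn : (1 <= n)%N)
    (Y : 'I_n -> 'M[R]_(q, p))
    (Theta : 'M[R]_p) (Psi : 'M[R]_q)
    (hTheta : Theta^T = Theta) (hPsi : Psi^T = Psi)
    (hpos : posdefmx (kronsum Theta Psi))
    (QTheta : 'M[R]_p) (lamTheta : 'rV[R]_p)
    (QPsi : 'M[R]_q) (lamPsi : 'rV[R]_q)
    (hdTheta : sorted_eigendecomposition Theta QTheta lamTheta)
    (hdPsi : sorted_eigendecomposition Psi QPsi lamPsi) :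
  let W := invmx (kronsum Theta Psi) in
  let XiTheta := fun k : 'I_q => Xi lamTheta lamPsi k in
  let XiPsi := fun l : 'I_p => Xi lamPsi lamTheta l in
  let LamHTheta := \sum_(k < q) (XiTheta k *t XiTheta k) in
  let LamHPsi := \sum_(l < p) (XiPsi l *t XiPsi l) in
  let Ups := Upsilon lamTheta lamPsi in
  let QQ := block_mx (QTheta *t QTheta) 0 0 (QPsi *t QPsi) in
  [/\ gradTheta (sampleS Y) W
        = q%:R *: sampleS Y
          - QTheta *m (\sum_(k < q) XiTheta k) *m QTheta^T,
      gradPsi (sampleT Y) W
        = p%:R *: sampleT Y
          - QPsi *m (\sum_(l < p) XiPsi l) *m QPsi^T,
      hessian W
        = block_mx (hessTheta W) (hessThetaPsi W)
                   (hessThetaPsi W)^T (hessPsi W)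
    & hessian W
        = QQ *m block_mx LamHTheta Ups Ups^T LamHPsi *m QQ^T].
Proof.
move=> W XiTheta XiPsi LamHTheta LamHPsi Ups QQ.
case: hdTheta => oT eT _; case: hdPsi => oP eP _.
have symW : W^T = W by rewrite /W trmx_inv hpos.1.
split.
- exact: gradThetaE hpos oT oP eT eP _.
- exact: gradPsiE hpos oT oP eT eP _.
- exact: hessian_block.
(* Since [QQ] is block diagonal, the conjugation acts blockwise; the lower left block follows by
   transposing the mixed identity. *)
rewrite hessian_block // /QQ tr_block_mx !trmx0 !mulmx_block.
rewrite !(mul0mx, mulmx0, addr0, add0r).
rewrite (hessThetaE hpos oT oP eT eP) (hessPsiE hpos oT oP eT eP).
by rewrite (hessThetaPsiE hpos oT oP eT eP) !trmx_mul !trmxK mulmxA.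
Qed.
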